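(* $$\sum_{k=0}^{\infty}\frac{\binom{2k}{k}^5}{(-2^{20})^k}\Big\{(820k^2+180k+13)(H_{2k}-H_k)+164k+18\Big\}=\frac{256\log 2}{\pi^2}.$$
   Context: For a nonnegative integer $n$, $H_n=\sum_{j=1}^{n}\frac{1}{j}$ denotes the classical harmonic number, with $H_0=0$. $\log$ is the natural logarithm. *)

(* Defs.v *)
From Stdlib Require Import Reals.
From Coquelicot Require Import Coquelicot.
Open Scope R_scope.

(* [sum_n_m f m n] is zero when [n < m], so [harmonic 0 = 0]. *)
Definition harmonic (n : nat) : R := sum_n_m (fun j : nat => / INR j) 1 n.

(* Main.v *)
Require Import Defs.
From Stdlib Require Import Reals Lra Lia.
From Coquelicot Require Import Coquelicot.
Open Scope R_scope.

(** Write [A(n) = C(2n,n)^5 / (-2^20)^n].  The series of the theorem is,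
    up to a constant factor, the termwise derivative of the companion series
    [sum A(n) (820 n^2 + 180 n + 13) = 128 / PI^2], taken in the second variable
    of a WZ pair that proves that companion.

    For a real parameter [k > -1/2] put
    [t(n,k) = (-1)^n ((k+1/2)_n / (k+1)_(2n))^4 (1/2)_n^6 / (2n)!], which equals
    [A(n)] at [k = 0].  There is an explicit rational weight [P(n,k)] such that,
    with [G = t P] and [F(n,k) = 2 n (6n + 1 + 4k) t(n,k)],
    [((k+1/2)/(k+1))^4 G(n,k+1) - G(n,k) = F(n+1,k) - F(n,k)]  ([wz_identity]).
    As [F] vanishes at [n = 0] for every [k] and tends to 0 as [n] grows, the sum
    [V(k) = sum_n G(n,k)] satisfies [V(k) = ((k+1/2)/(k+1))^4 V(k+1)].
    The identity holds for real [k], so it may be differentiated in [k]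
    ([dwz_identity]); the derived [F] again vanishes at [n = 0], and the sum
    [V'(k)] of the derivatives satisfies the differentiated recurrence.  No
    exchange of sum and derivative is involved: [V'] denotes the sum of the
    termwise derivatives, and only integer [k] are used in the end.

    Iterating up to [k = N], with [w_N = C(2N,N) / 4^N],
    [V(0) = w_N^4 V(N)] and
    [V'(0) = w_N^4 V'(N) + 8 (H_(2N) - H_N) V(0)]  ([wz_sum_iterate]).
    For large [N] only the term [n = 0] matters, so [V(N) = 2 N^2 + O(N)] and
    [V'(N) = O(N)].  Wallis' [N w_N^2 -> 1/PI] and [H_(2N) - H_N -> ln 2] then give
    [V(0) = 2 / PI^2] and [V'(0) = 8 ln 2 V(0) = 16 ln 2 / PI^2].

    Finally [P(n,0) = (820 n^2 + 180 n + 13) / 64], the [k]-derivative of [P] at 0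
    is [4 (164 n + 18) / 64], and that of [ln |t|] is [4 (H_(2n) - H_n)].  So the
    terms of [V'(0)] are those of the theorem divided by 16. *)

(** * Wallis' asymptotics of the central binomial coefficient *)

Definition central_ratio (n : nat) : R := Binomial.C (2 * n) n / 4 ^ n.

Lemma central_ratio_0 : central_ratio 0 = 1.
Proof. unfold central_ratio, Binomial.C. cbn. field. Qed.

Lemma central_ratio_S n : central_ratio (S n) = central_ratio n * ((INR n + 1/2) / (INR n + 1)).
Proof.
  unfold central_ratio, Binomial.C.
  replace (2 * S n - S n)%nat with (S n) by lia.
  replace (2 * n - n)%nat with n by lia.
  replace (2 * S n)%nat with (S (S (2 * n))) by lia.
  rewrite !fact_simpl, !mult_INR, !S_INR, !mult_INR.
  assert (H1 := INR_fact_neq_0 n). assert (H2 := pos_INR n).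
  assert (H3 : 4 ^ n <> 0) by (apply pow_nonzero; lra).
  cbn [pow INR]. field. repeat split; try assumption; lra.
Qed.

Lemma central_ratio_pos n : 0 < central_ratio n.
Proof.
  induction n as [|n IH]; [rewrite central_ratio_0; lra|].
  rewrite central_ratio_S. assert (H := pos_INR n).
  apply Rmult_lt_0_compat; [exact IH|]. apply Rdiv_lt_0_compat; lra.
Qed.

Definition wallis (n : nat) : R := RInt (fun x => sin x ^ n) 0 (PI / 2).

Lemma ex_RInt_sin_pow n : ex_RInt (fun x => sin x ^ n) 0 (PI / 2).
Proof.
  apply (ex_RInt_continuous (V := R_CompleteNormedModule)). intros x _.
  apply (ex_derive_continuous (fun x => sin x ^ n)). auto_derive. easy.
Qed.

Lemma wallis_0 : wallis 0 = PI / 2.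
Proof.
  unfold wallis. cbn [pow]. rewrite RInt_const. unfold scal; cbn. unfold mult; cbn. ring.
Qed.

Lemma wallis_1 : wallis 1 = 1.
Proof.
  unfold wallis. apply is_RInt_unique.
  replace 1 with (minus (- cos (PI / 2)) (- cos 0)).
  - apply (is_RInt_derive (V := R_CompleteNormedModule) (fun x => - cos x)).
    + intros x _. auto_derive; [easy | ring].
    + intros x _. apply (ex_derive_continuous (fun x => sin x ^ 1)). auto_derive. easy.
  - rewrite cos_PI2, cos_0. unfold minus, plus, opp; cbn. ring.
Qed.

(** Integrates the derivative of [- cos x * sin x ^ (n+1)], which vanishes at both
    ends of the interval. *)
Lemma wallis_SS n : (INR n + 2) * wallis (S (S n)) = (INR n + 1) * wallis n.
Proof.
  assert (H : is_RInt (fun x => minus (scal (INR n + 2) (sin x ^ S (S n)))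
                                      (scal (INR n + 1) (sin x ^ n))) 0 (PI / 2)
            (minus (scal (INR n + 2) (wallis (S (S n)))) (scal (INR n + 1) (wallis n)))).
  { apply (is_RInt_minus (V := R_NormedModule));
      apply (is_RInt_scal (V := R_NormedModule));
      apply (RInt_correct (V := R_CompleteNormedModule));
      apply ex_RInt_sin_pow. }
  assert (H' : is_RInt (fun x => minus (scal (INR n + 2) (sin x ^ S (S n)))
                                      (scal (INR n + 1) (sin x ^ n))) 0 (PI / 2)
     (minus (- cos (PI / 2) * sin (PI / 2) ^ S n) (- cos 0 * sin 0 ^ S n))).
  { apply (is_RInt_derive (V := R_CompleteNormedModule)
             (fun x => - cos x * sin x ^ S n)).
    - intros x _. unfold minus, plus, opp, scal; cbn -[INR]; unfold mult; cbn -[INR].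
      assert (Hc : cos x * cos x = 1 - sin x * sin x)
        by (generalize (sin2_cos2 x); unfold Rsqr; lra).
      assert (Hp : INR n * (sin x * sin x ^ pred n) = INR n * sin x ^ n)
        by (destruct n; [cbn; ring | reflexivity]).
      auto_derive; [easy|].
      transitivity (sin x * sin x * sin x ^ n - cos x * cos x * sin x ^ n
                    - cos x * cos x * (INR n * (sin x * sin x ^ pred n))).
      + ring.
      + rewrite Hp, Hc. ring.
    - intros x _.
      apply (ex_derive_continuous
        (fun x => minus (scal (INR n + 2) (sin x ^ S (S n)))
                        (scal (INR n + 1) (sin x ^ n)))).
      unfold minus, plus, opp, scal; cbn -[INR]; unfold mult; cbn -[INR].
      auto_derive. easy. }
  assert (E := eq_trans (eq_sym (is_RInt_unique _ _ _ _ H)) (is_RInt_unique _ _ _ _ H')).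
  rewrite cos_PI2, sin_0 in E. unfold minus, plus, opp, scal in E; cbn -[INR wallis] in E.
  unfold mult in E; cbn -[INR wallis] in E. lra.
Qed.

Lemma wallis_decr n : wallis (S n) <= wallis n.
Proof.
  assert (HPI := PI_RGT_0).
  apply RInt_le; [lra | apply ex_RInt_sin_pow .. |].
  intros x Hx. cbn. assert (0 <= sin x) by (apply sin_ge_0; lra).
  assert (H1 := SIN_bound x). assert (0 <= sin x ^ n) by now apply pow_le.
  nra.
Qed.

Lemma wallis_central_ratio n :
  wallis (2 * n) = PI / 2 * central_ratio n /\ (2 * INR n + 1) * central_ratio n * wallis (2 * n + 1) = 1.
Proof.
  induction n as [|n [IH1 IH2]].
  - cbn [Nat.mul Nat.add]. rewrite wallis_0, wallis_1, central_ratio_0. cbn [INR]. lra.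
  - assert (Hn := pos_INR n).
    assert (E1 := wallis_SS (2 * n)). assert (E2 := wallis_SS (2 * n + 1)).
    rewrite plus_INR, mult_INR in E2. rewrite mult_INR in E1. cbn [INR] in E1, E2.
    replace (2 * S n)%nat with (S (S (2 * n))) by lia.
    replace (S (S (2 * n)) + 1)%nat with (S (S (2 * n + 1))) by lia.
    rewrite central_ratio_S, S_INR. split.
    + rewrite IH1 in E1. apply Rmult_eq_reg_l with ((1 + 1) * INR n + 2); [|lra].
      rewrite E1. field. lra.
    + rewrite <- S_INR.
      transitivity ((2 * INR n + 1) * central_ratio n * wallis (2 * n + 1)); [|exact IH2].
      replace (wallis (S (S (2 * n + 1))))
        with ((2 * INR n + 2) / (2 * INR n + 3) * wallis (2 * n + 1)).
      * rewrite S_INR. field. lra.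
      * apply Rmult_eq_reg_l with ((1 + 1) * INR n + 1 + 2); [|lra].
        rewrite E2. field. lra.
Qed.

(** The Wallis integrals decrease, so the one of index [2n] lies between those of
    indices [2n+1] and [2n-1], which are the inverses of [(2n+1) w_n] and [2n w_n]. *)
Lemma central_ratio_sqr_bounds n :
  2 / (2 * INR n + 1) <= PI * central_ratio n ^ 2 /\ INR n * (PI * central_ratio n ^ 2) <= 1.
Proof.
  destruct (wallis_central_ratio n) as [E1 E2]. assert (Hn := pos_INR n).
  assert (Hc := central_ratio_pos n). assert (HPI := PI_RGT_0). split.
  - assert (H := wallis_decr (2 * n)). replace (S (2 * n)) with (2 * n + 1)%nat in H by lia.
    rewrite E1 in H.
    apply Rmult_le_reg_l with (2 * INR n + 1); [lra|].
    replace ((2 * INR n + 1) * (2 / (2 * INR n + 1)))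
      with (2 * ((2 * INR n + 1) * central_ratio n * wallis (2 * n + 1)))
      by (rewrite E2; field; lra).
    assert (0 < (2 * INR n + 1) * central_ratio n) by nra. nra.
  - destruct n as [|n]; [cbn; lra|].
    destruct (wallis_central_ratio n) as [_ E3].
    assert (H := wallis_decr (2 * n + 1)).
    replace (S (2 * n + 1)) with (2 * S n)%nat in H by lia.
    rewrite E1 in H. assert (Hc' := central_ratio_pos n). assert (Hn' := pos_INR n).
    assert (E : INR (S n) * central_ratio (S n) = (INR n + 1/2) * central_ratio n)
      by (rewrite central_ratio_S, S_INR; field; lra).
    replace (INR (S n) * (PI * central_ratio (S n) ^ 2))
      with (2 * (INR (S n) * central_ratio (S n)) * (PI / 2 * central_ratio (S n))) by field.
    rewrite E.
    assert (0 < (2 * INR n + 1) * central_ratio n) by nra. nra.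
Qed.

Lemma wallis_limit : is_lim_seq (fun n => INR n * central_ratio n ^ 2) (/ PI).
Proof.
  assert (HPI := PI_RGT_0).
  apply is_lim_seq_le_le with
    (fun n => / PI - / PI * / (2 * INR n + 1)) (fun _ => / PI).
  - intros n. destruct (central_ratio_sqr_bounds n) as [H1 H2]. assert (Hn := pos_INR n).
    split; apply Rmult_le_reg_l with PI; try lra.
    + apply Rle_trans with (INR n * (2 / (2 * INR n + 1))).
      * right. field. lra.
      * replace (PI * (INR n * central_ratio n ^ 2)) with (INR n * (PI * central_ratio n ^ 2)) by ring.
        now apply Rmult_le_compat_l.
    + rewrite Rinv_r by lra. lra.
  - replace (Finite (/ PI)) with (Finite (/ PI - / PI * 0)) by (f_equal; ring).
    apply is_lim_seq_minus'; [apply is_lim_seq_const|].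
    apply is_lim_seq_mult'; [apply is_lim_seq_const|].
    apply (is_lim_seq_inv _ p_infty); [|easy].
    apply is_lim_seq_le_p_loc with INR; [|apply is_lim_seq_INR].
    exists 0%nat. intros n _. assert (Hn := pos_INR n). lra.
  - apply is_lim_seq_const.
Qed.

Lemma central_ratio_pow4_bound n : INR n ^ 2 * central_ratio n ^ 4 <= 1.
Proof.
  destruct (central_ratio_sqr_bounds n) as [_ H]. assert (Hn := pos_INR n).
  assert (HPI := PI2_1).
  assert (H0 : 0 <= INR n * central_ratio n ^ 2)
    by (apply Rmult_le_pos; [lra | apply pow2_ge_0]).
  assert (H1 : INR n * central_ratio n ^ 2 <= 1) by nra.
  replace (INR n ^ 2 * central_ratio n ^ 4) with ((INR n * central_ratio n ^ 2) ^ 2) by ring.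
  rewrite <- (pow1 2). apply pow_incr. lra.
Qed.

(** [w_n^4] is of order [1/n^2], which absorbs every error of linear growth; this is
    what discards the tails of both sums at parameter [n]. *)
Lemma central_ratio_pow4_mult_affine (c d : R) :
  is_lim_seq (fun n => central_ratio n ^ 4 * (c * INR n + d)) 0.
Proof.
  assert (Hinv : is_lim_seq (fun n => / INR n) 0).
  { apply (is_lim_seq_inv _ p_infty); [apply is_lim_seq_INR | easy]. }
  apply is_lim_seq_abs_0.
  apply is_lim_seq_le_le_loc with
    (fun _ => 0) (fun n => Rabs c * / INR n + Rabs d * (/ INR n * / INR n)).
  - exists 1%nat. intros n Hn. split; [apply Rabs_pos|].
    assert (Hp : 0 < INR n) by (apply lt_0_INR; lia).
    assert (H4 : 0 < central_ratio n ^ 4) by (apply pow_lt, central_ratio_pos).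
    assert (Hb : central_ratio n ^ 4 <= / INR n * / INR n).
    { apply Rmult_le_reg_l with (INR n ^ 2); [now apply pow_lt|].
      replace (INR n ^ 2 * (/ INR n * / INR n)) with 1 by (field; lra).
      apply central_ratio_pow4_bound. }
    rewrite Rabs_mult, (Rabs_pos_eq (central_ratio n ^ 4)) by lra.
    replace (Rabs c * / INR n + Rabs d * (/ INR n * / INR n))
      with (/ INR n * / INR n * (Rabs c * INR n + Rabs d)) by (field; lra).
    apply Rmult_le_compat; [lra | apply Rabs_pos | exact Hb |].
    eapply Rle_trans; [apply Rabs_triang|].
    rewrite Rabs_mult, (Rabs_pos_eq (INR n)); lra.
  - apply is_lim_seq_const.
  - replace (Finite 0) with (Finite (Rabs c * 0 + Rabs d * (0 * 0))) by (f_equal; ring).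
    apply is_lim_seq_plus'; repeat apply is_lim_seq_mult';
      first [exact Hinv | apply is_lim_seq_const].
Qed.

(** * The logarithm of two as a limit of harmonic differences *)

Definition harmonic_gap (n : nat) : R := harmonic (2 * n) - harmonic n.

Lemma harmonic_S n : harmonic (S n) = harmonic n + / (INR n + 1).
Proof.
  unfold harmonic. rewrite sum_n_Sm by lia. rewrite S_INR. reflexivity.
Qed.

Lemma harmonic_gap_0 : harmonic_gap 0 = 0.
Proof. unfold harmonic_gap. cbn. lra. Qed.

Lemma harmonic_gap_S n :
  harmonic_gap (S n) = harmonic_gap n + / (2 * INR n + 1) + / (2 * INR n + 2) - / (INR n + 1).
Proof.
  unfold harmonic_gap. replace (2 * S n)%nat with (S (S (2 * n))) by lia.
  rewrite !harmonic_S, S_INR, mult_INR. cbn [INR].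
  replace (1 + 1) with 2 by ring.
  replace (2 * INR n + 1 + 1) with (2 * INR n + 2) by ring. ring.
Qed.

Lemma ln_le_sub_1 x : 0 < x -> ln x <= x - 1.
Proof.
  intros Hx. assert (H := exp_ineq1_le (ln x)). rewrite exp_ln in H by exact Hx. lra.
Qed.

(** Each step compares [1/(x+1)] with [ln ((x+1)/x)]; the term [/ m - / (m+n)] is the
    telescoped sum of the gaps [1/x - 1/(x+1)] between the two bounds of that logarithm. *)
Lemma harmonic_sub_bounds m n : (0 < m)%nat ->
  ln (INR (m + n)) - ln (INR m) - (/ INR m - / INR (m + n))
  <= harmonic (m + n) - harmonic m <= ln (INR (m + n)) - ln (INR m).
Proof.
  intros Hm. induction n as [|n IH].
  - rewrite Nat.add_0_r. lra.
  - rewrite Nat.add_succ_r, harmonic_S, S_INR.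
    assert (Hp : 0 < INR (m + n)) by (apply lt_0_INR; lia).
    set (x := INR (m + n)) in *.
    assert (H1 := ln_le_sub_1 ((x + 1) / x) ltac:(apply Rdiv_lt_0_compat; lra)).
    assert (H2 := ln_le_sub_1 (x / (x + 1)) ltac:(apply Rdiv_lt_0_compat; lra)).
    rewrite ln_div in H1, H2 by lra.
    replace ((x + 1) / x - 1) with (/ x) in H1 by (field; lra).
    replace (x / (x + 1) - 1) with (- / (x + 1)) in H2 by (field; lra).
    lra.
Qed.

Lemma harmonic_gap_limit : is_lim_seq harmonic_gap (ln 2).
Proof.
  apply is_lim_seq_incr_1.
  apply is_lim_seq_le_le with (fun n => ln 2 - / 2 * / INR (S n)) (fun _ => ln 2).
  - intros n. unfold harmonic_gap.
    assert (H := harmonic_sub_bounds (S n) (S n) ltac:(lia)).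
    replace (S n + S n)%nat with (2 * S n)%nat in H by lia.
    assert (Hp : 0 < INR (S n)) by (apply lt_0_INR; lia).
    rewrite mult_INR in H. replace (INR 2) with 2 in H by (cbn; ring).
    rewrite ln_mult in H by lra.
    replace (/ INR (S n) - / (2 * INR (S n))) with (/ 2 * / INR (S n)) in H by (field; lra).
    lra.
  - replace (Finite (ln 2)) with (Finite (ln 2 - / 2 * 0)) by (f_equal; ring).
    apply is_lim_seq_minus'; [apply is_lim_seq_const|].
    apply is_lim_seq_mult'; [apply is_lim_seq_const|].
    apply (is_lim_seq_inv _ p_infty); [|easy].
    apply (is_lim_seq_incr_1 INR). apply is_lim_seq_INR.
  - apply is_lim_seq_const.
Qed.

(** * A WZ pair with a real parameter *)

(** Closed form: [(-1)^n ((k+1/2)_n / (k+1)_(2n))^4 (1/2)_n^6 / (2n)!].  The recursive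
    form makes sense for real [k] without the Gamma function. *)
Fixpoint term (n : nat) (k : R) : R :=
  match n with
  | O => 1
  | S n' =>
      term n' k
      * - (((k + INR n' + 1/2) / ((k + 2 * INR n' + 1) * (k + 2 * INR n' + 2))) ^ 4
           * ((INR n' + 1/2) ^ 5 / (4 * (INR n' + 1))))
  end.

(** Derivative in [k] of the logarithm of [|term n k|]. *)
Fixpoint dlog_term (n : nat) (k : R) : R :=
  match n with
  | O => 0
  | S n' =>
      dlog_term n' k
      + (4 / (k + INR n' + 1/2) - 4 / (k + 2 * INR n' + 1)
         - 4 / (k + 2 * INR n' + 2))
  end.

(** With [m = n + 1/2] and [b = k + 2n + 1] this is
    [2 (b-1)^2 + 2 m (b-1) + m^2 - m^5 (2b - m) / b^4].  It is the solution of Gosper's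
    equation in [k] for [F(n+1,k) - F(n,k)]. *)
Definition weight (n : nat) (k : R) : R :=
  2 * (k + 2 * INR n) ^ 2 + 2 * (INR n + 1/2) * (k + 2 * INR n) + (INR n + 1/2) ^ 2
  - (INR n + 1/2) ^ 5 * (2 * k + 3 * INR n + 3/2) / (k + 2 * INR n + 1) ^ 4.

Definition dweight (n : nat) (k : R) : R :=
  4 * (k + 2 * INR n) + 2 * (INR n + 1/2)
  + (INR n + 1/2) ^ 5
    * (6 / (k + 2 * INR n + 1) ^ 4 - 4 * (INR n + 1/2) / (k + 2 * INR n + 1) ^ 5).

(** The factor [n] is what makes [antidiff] and [dantidiff] vanish at [n = 0]. *)
Definition certificate (n : nat) (k : R) : R :=
  2 * INR n * (6 * INR n + 1 + 4 * k).

Definition summand n k := term n k * weight n k.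
Definition dsummand n k := term n k * (dlog_term n k * weight n k + dweight n k).
Definition antidiff n k := term n k * certificate n k.
Definition dantidiff n k := term n k * (dlog_term n k * certificate n k + 8 * INR n).

(** Ratio of the values of [(Gamma (k+1/2) / Gamma (k+1))^4] at [k+1] and at [k], the
    prefactor left out of [term]. *)
Definition shift_ratio (k : R) : R := ((k + 1/2) / (k + 1)) ^ 4.

(** Shifting [k] changes only the four quotients [(k+1/2)_n / (k+1)_(2n)], and those by
    a telescoping factor.  Hence every term of [wz_identity] is a rational multiple of
    [term n k]. *)
Lemma term_shift n k : -1/2 < k ->
  shift_ratio k * term n (k + 1)
  = term n k * ((k + INR n + 1/2) / (k + 2 * INR n + 1)) ^ 4.
Proof.
  intros Hk. induction n as [|n IH].
  - simpl. unfold shift_ratio. field. lra.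
  - cbn [term]. rewrite <- Rmult_assoc, IH, S_INR.
    assert (Hn := pos_INR n). field. repeat split; lra.
Qed.

Lemma wz_identity n k : -1/2 < k ->
  shift_ratio k * summand n (k + 1) - summand n k
  = antidiff (S n) k - antidiff n k.
Proof.
  intros Hk. unfold summand, antidiff. rewrite <- Rmult_assoc, term_shift by exact Hk.
  cbn [term]. unfold weight, certificate. rewrite S_INR.
  assert (Hn := pos_INR n).
  generalize dependent (INR n). intros x Hx.
  field. repeat split; lra.
Qed.

Lemma is_derive_term n k : -1/2 < k ->
  is_derive (term n) k (term n k * dlog_term n k).
Proof.
  intros Hk. induction n as [|n IH].
  - cbn. auto_derive; [easy | ring].
  - cbn [term dlog_term].
    assert (Hn := pos_INR n).
    auto_derive.
    + repeat split; [now eexists; apply IH | ].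
      repeat apply Rmult_integral_contrapositive_currified; lra.
    + rewrite (is_derive_unique (fun x : R => term n x) _ _ IH). field. repeat split; lra.
Qed.

Lemma is_derive_summand n k : -1/2 < k -> is_derive (summand n) k (dsummand n k).
Proof.
  intros Hk. assert (Ht := is_derive_term n k Hk). assert (Hn := pos_INR n).
  unfold summand, dsummand, weight, dweight. auto_derive.
  - repeat split; [now eexists; apply Ht | ].
    repeat apply Rmult_integral_contrapositive_currified; lra.
  - rewrite (is_derive_unique (fun x : R => term n x) _ _ Ht). field. lra.
Qed.

Lemma is_derive_antidiff n k : -1/2 < k -> is_derive (antidiff n) k (dantidiff n k).
Proof.
  intros Hk. assert (Ht := is_derive_term n k Hk).
  unfold antidiff, dantidiff, certificate. auto_derive.
  - now eexists; apply Ht.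
  - rewrite (is_derive_unique (fun x : R => term n x) _ _ Ht). ring.
Qed.

(** The two sides of [wz_identity] agree as functions near [k], hence so do their
    derivatives; [4 / (k+1/2) - 4 / (k+1)] is the logarithmic derivative of
    [shift_ratio]. *)
Lemma dwz_identity n k : -1/2 < k ->
  shift_ratio k
    * (dsummand n (k + 1) + (4 / (k + 1/2) - 4 / (k + 1)) * summand n (k + 1))
    - dsummand n k
  = dantidiff (S n) k - dantidiff n k.
Proof.
  intros Hk.
  assert (HG1 := is_derive_summand n (k + 1) ltac:(lra)).
  assert (HG := is_derive_summand n k Hk).
  assert (HF1 := is_derive_antidiff (S n) k Hk).
  assert (HF := is_derive_antidiff n k Hk).
  assert (Hl : is_derive (fun x => shift_ratio x * summand n (x + 1) - summand n x) k
    (shift_ratio k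
    * (dsummand n (k + 1) + (4 / (k + 1/2) - 4 / (k + 1)) * summand n (k + 1))
    - dsummand n k)).
  { unfold shift_ratio. auto_derive.
    - repeat split; try (now eexists; eassumption); lra.
    - rewrite (is_derive_unique (fun x : R => summand n x) _ _ HG),
        (is_derive_unique (fun x : R => summand n x) _ _ HG1).
      field. lra. }
  assert (Hr : is_derive (fun x => antidiff (S n) x - antidiff n x) k (dantidiff (S n) k - dantidiff n k)).
  { auto_derive.
    - repeat split; now eexists; eassumption.
    - rewrite (is_derive_unique (fun x : R => antidiff n x) _ _ HF),
        (is_derive_unique (fun x : R => antidiff (S n) x) _ _ HF1). ring. }
  rewrite <- (is_derive_unique _ _ _ Hl), <- (is_derive_unique _ _ _ Hr).
  apply Derive_ext_loc.
  apply filter_imp with (fun x => -1/2 < x).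
  - intros x Hx. now apply wz_identity.
  - now apply open_gt.
Qed.

(** * Size estimates uniform in the parameter *)

(** The step from [term n k] to [term (n+1) k] is a product of [u^4 / 4] and factors
    of absolute value at most 1, with [u = (x+1/2) / (k+2x+2)].  One always has
    [u <= 1/2], and for [x = 0] the quantity [u^4] also decays like [k^-4]. *)
Lemma ratio_bound k x : 0 <= k -> 0 <= x ->
  Rabs (- (((k + x + 1/2) / ((k + 2 * x + 1) * (k + 2 * x + 2))) ^ 4
           * ((x + 1/2) ^ 5 / (4 * (x + 1)))))
  <= ((x + 1/2) / (k + 2 * x + 2)) ^ 4 / 4.
Proof.
  intros Hk Hx. rewrite Rabs_Ropp.
  set (u := (x + 1/2) / (k + 2 * x + 2)).
  set (v := (k + x + 1/2) / (k + 2 * x + 1)).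
  set (w := (x + 1/2) / (x + 1)).
  assert (Hu : 0 <= u) by (apply Rdiv_le_0_compat; lra).
  assert (Hv : 0 <= v <= 1).
  { split; [apply Rdiv_le_0_compat; lra|]. apply Rle_div_l; lra. }
  assert (Hw : 0 <= w <= 1).
  { split; [apply Rdiv_le_0_compat; lra|]. apply Rle_div_l; lra. }
  match goal with |- Rabs ?e <= _ => replace e with (v ^ 4 * (w * (u ^ 4 / 4))) end.
  2: { unfold u, v, w. field. lra. }
  assert (Hv4 : 0 <= v ^ 4 <= 1).
  { split; [apply pow_le; lra|]. rewrite <- (pow1 4). apply pow_incr. lra. }
  assert (Hu4 : 0 <= u ^ 4 / 4) by (assert (0 <= u ^ 4) by (apply pow_le; lra); lra).
  assert (0 <= w * (u ^ 4 / 4) <= u ^ 4 / 4) by nra.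
  rewrite Rabs_pos_eq; nra.
Qed.

(** The first step supplies the decay [(k+1)^-3], every step a factor [1/64].  The
    decay in [k] makes the terms with [n >= 1] negligible as [k] grows. *)
Lemma term_S_bound n k : 0 <= k ->
  Rabs (term (S n) k) * (k + 1) ^ 3 <= (1/64) ^ S n.
Proof.
  intros Hk. induction n as [|n IH].
  - cbn [term]. rewrite Rmult_1_l.
    eapply Rle_trans.
    { apply Rmult_le_compat_r; [apply pow_le; lra|]. cbn [INR]. now apply ratio_bound; [|lra]. }
    rewrite pow_1.
    assert (H : 0 < (k + 2) ^ 4) by (apply pow_lt; lra).
    match goal with |- ?e <= _ =>
      replace e with ((k + 1) ^ 3 * / (64 * (k + 2) ^ 4)) by (field; lra) end.
    apply Rle_div_l; [lra|].
    assert (0 <= k ^ 2 /\ 0 <= k ^ 3 /\ 0 <= k ^ 4) by (repeat split; apply pow_le; lra).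
    replace ((k + 2) ^ 4) with (k ^ 4 + 8 * k ^ 3 + 24 * k ^ 2 + 32 * k + 16) by ring.
    replace ((k + 1) ^ 3) with (k ^ 3 + 3 * k ^ 2 + 3 * k + 1) by ring. lra.
  - remember (S n) as m eqn:Em.
    cbn [term]. rewrite Rabs_mult.
    assert (Hm := pos_INR m).
    assert (H := ratio_bound k (INR m) Hk Hm).
    assert (H' : ((INR m + 1/2) / (k + 2 * INR m + 2)) ^ 4 / 4 <= 1/64).
    { assert (Hu : 0 <= (INR m + 1/2) / (k + 2 * INR m + 2) <= 1/2).
      { split; [apply Rdiv_le_0_compat; lra|]. apply Rle_div_l; lra. }
      assert (Hp := pow_incr _ _ 4 Hu). replace ((1/2) ^ 4) with (1/16) in Hp by field. lra. }
    rewrite Rmult_assoc, (Rmult_comm (Rabs (- _))), <- Rmult_assoc.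
    rewrite <- (tech_pow_Rmult _ m), (Rmult_comm (1/64)).
    apply Rmult_le_compat; [|apply Rabs_pos | exact IH | lra].
    apply Rmult_le_pos; [apply Rabs_pos | apply pow_le; lra].
Qed.

(** [k + 2n + 1 <= (k+1) (2n+1) <= 2 (k+1) 2^n], so the cube costs [8 (k+1)^3 8^n] and
    leaves a geometric bound of ratio [64^-1 * 8], the same for all [k]. *)
Lemma term_S_cube_bound n k : 0 <= k ->
  Rabs (term (S n) k) * (k + 2 * INR (S n) + 1) ^ 3 <= (1/8) ^ n.
Proof.
  intros Hk. assert (Hx := pos_INR (S n)).
  assert (Hb : (k + 2 * INR (S n) + 1) ^ 3 <= (k + 1) ^ 3 * (8 * 8 ^ S n)).
  { replace (8 * 8 ^ S n) with ((2 * 2 ^ S n) ^ 3).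
    2: { rewrite Rpow_mult_distr, <- pow_mult, Nat.mul_comm, pow_mult.
         replace (2 ^ 3) with 8 by ring. ring. }
    rewrite <- Rpow_mult_distr. apply pow_incr. split; [lra|].
    assert (H2 : INR (S n) + 1 <= 2 ^ S n).
    { generalize (S n). clear. intros n. induction n as [|n IH]; [cbn; lra|].
      rewrite S_INR. cbn [pow]. assert (H := pos_INR n). lra. }
    nra. }
  assert (Ht := term_S_bound n k Hk).
  assert (E : (1/64) ^ S n * (8 * 8 ^ S n) = (1/8) ^ n).
  { rewrite (Rmult_comm 8), <- Rmult_assoc, <- Rpow_mult_distr.
    replace (1/64 * 8) with (1/8) by field. cbn [pow]. field. }
  rewrite <- E.
  eapply Rle_trans; [apply Rmult_le_compat_l; [apply Rabs_pos | exact Hb]|].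
  rewrite <- Rmult_assoc. apply Rmult_le_compat_r; [|exact Ht].
  assert (0 < 8 ^ S n) by (apply pow_lt; lra). lra.
Qed.

Lemma dlog_term_bound n k : 0 <= k -> Rabs (dlog_term n k) <= 8 * INR n.
Proof.
  intros Hk. induction n as [|n IH].
  - cbn. rewrite Rabs_R0. lra.
  - cbn [dlog_term]. rewrite S_INR. assert (Hn := pos_INR n).
    eapply Rle_trans; [apply Rabs_triang|].
    assert (H1 : 0 <= 4 / (k + INR n + 1/2) <= 8).
    { split; [apply Rdiv_le_0_compat; lra | apply Rle_div_l; lra]. }
    assert (H2 : 0 <= 4 / (k + 2 * INR n + 1) <= 4).
    { split; [apply Rdiv_le_0_compat; lra | apply Rle_div_l; lra]. }
    assert (H3 : 0 <= 4 / (k + 2 * INR n + 2) <= 4).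
    { split; [apply Rdiv_le_0_compat; lra | apply Rle_div_l; lra]. }
    assert (Rabs (4 / (k + INR n + 1/2) - 4 / (k + 2 * INR n + 1) - 4 / (k + 2 * INR n + 2)) <= 8)
      by (apply Rabs_le; lra).
    lra.
Qed.

Lemma weight_bounds n k : 0 <= k ->
  Rabs (weight n k) <= 4 * (k + 2 * INR n + 1) ^ 2
  /\ Rabs (dweight n k) <= 6 * (k + 2 * INR n + 1).
Proof.
  intros Hk. unfold weight, dweight. assert (Hn := pos_INR n).
  set (m := INR n + 1/2). set (b := k + 2 * INR n + 1).
  assert (Hm : 1/2 <= m) by (unfold m; lra).
  assert (Hb : 1 <= b) by (unfold b; lra).
  assert (Hmb : 2 * m <= b) by (unfold m, b; lra).
  replace (k + 2 * INR n) with (b - 1) by (unfold b; ring).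
  replace (2 * k + 3 * INR n + 3/2) with (2 * b - m) by (unfold b, m; field).
  set (q := m / b).
  assert (Hq : 0 <= q <= 1/2).
  { unfold q. split; [apply Rdiv_le_0_compat; lra | apply Rle_div_l; lra]. }
  assert (Hq2 : 0 <= q ^ 2 <= 1/4) by (cbn; nra).
  assert (Hq4 : 0 <= q ^ 4 <= 1/16) by (replace (q ^ 4) with (q ^ 2 * q ^ 2) by ring; nra).
  replace (m ^ 5 * (2 * b - m) / b ^ 4) with (q ^ 4 * (m * (2 * b - m)))
    by (unfold q; field; lra).
  replace (m ^ 5 * (6 / b ^ 4 - 4 * m / b ^ 5)) with (q ^ 4 * (m * (6 - 4 * q)))
    by (unfold q; field; lra).
  split; apply Rabs_le.
  - assert (0 <= m * (2 * b - m) <= b ^ 2) by nra.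
    assert (0 <= q ^ 4 * (m * (2 * b - m)) <= 1/16 * b ^ 2) by nra.
    nra.
  - assert (0 <= m * (6 - 4 * q) <= 3 * b) by nra.
    assert (0 <= q ^ 4 * (m * (6 - 4 * q)) <= 1/16 * (3 * b)) by nra.
    nra.
Qed.

(** The weights have degree 2 in [k + 2n + 1] and the logarithmic derivative degree 1,
    so the cube controls all four quantities at once. *)
Lemma wz_pair_bounds n k : 0 <= k ->
  let M := 24 * (Rabs (term n k) * (k + 2 * INR n + 1) ^ 3) in
  Rabs (summand n k) <= M /\ Rabs (dsummand n k) <= M
  /\ Rabs (antidiff n k) <= M /\ Rabs (dantidiff n k) <= M.
Proof.
  intros Hk M. unfold summand, dsummand, antidiff, dantidiff, M.
  destruct (weight_bounds n k Hk) as [Hw Hdw].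
  assert (HL := dlog_term_bound n k Hk).
  assert (Hn := pos_INR n).
  assert (HA : 0 <= certificate n k) by (unfold certificate; apply Rmult_le_pos; lra).
  assert (HA' : certificate n k <= 4 * (k + 2 * INR n + 1) ^ 2) by (unfold certificate; nra).
  assert (Hb : 1 <= k + 2 * INR n + 1) by lra.
  assert (Hnb : 2 * INR n <= k + 2 * INR n + 1) by lra.
  set (b := k + 2 * INR n + 1) in *.
  assert (Hb2 : b <= b ^ 2) by nra.
  assert (Hb3 : b ^ 2 <= b ^ 3) by (cbn; nra).
  assert (HLb : Rabs (dlog_term n k) <= 4 * b) by lra.
  assert (Hmain : forall c, Rabs c <= 24 * b ^ 3 ->
            Rabs (term n k * c) <= 24 * (Rabs (term n k) * b ^ 3)).
  { intros c Hc. rewrite Rabs_mult. assert (H := Rabs_pos (term n k)). nra. }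
  assert (Hprod : forall c, Rabs c <= 4 * b ^ 2 ->
            Rabs (dlog_term n k * c) <= 16 * b ^ 3).
  { intros c Hc. rewrite Rabs_mult. replace (16 * b ^ 3) with ((4 * b) * (4 * b ^ 2)) by ring.
    apply Rmult_le_compat; try apply Rabs_pos; assumption. }
  repeat split; apply Hmain.
  - lra.
  - eapply Rle_trans; [apply Rabs_triang|]. specialize (Hprod _ Hw). lra.
  - rewrite Rabs_pos_eq by exact HA. lra.
  - eapply Rle_trans; [apply Rabs_triang|].
    assert (H := Hprod (certificate n k) ltac:(rewrite Rabs_pos_eq; lra)).
    rewrite (Rabs_pos_eq (8 * INR n)) by lra. lra.
Qed.

(** * Summation over n and the recurrence in k *)

Lemma is_series_geom_8 : is_series (fun n => 24 * (1/8) ^ n) (24 * / (1 - 1/8)).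
Proof.
  apply (is_series_scal_l (K := R_AbsRing) (V := R_NormedModule) 24).
  apply is_series_geom. rewrite Rabs_pos_eq; lra.
Qed.

(** The head [a 0] is left free because at [n = 0] the summands grow with [k], while
    this bound on the rest does not depend on [k]. *)
Definition tail_small (a : nat -> R) : Prop :=
  forall n, Rabs (a (S n)) <= 24 * (1/8) ^ n.

Lemma wz_pair_tail_small k : 0 <= k ->
  tail_small (fun n => summand n k) /\ tail_small (fun n => dsummand n k)
  /\ tail_small (fun n => antidiff n k) /\ tail_small (fun n => dantidiff n k).
Proof.
  intros Hk.
  repeat split; intros n;
    destruct (wz_pair_bounds (S n) k Hk) as (H1 & H2 & H3 & H4);
    assert (H := term_S_cube_bound n k Hk); lra.
Qed.

Lemma tail_small_ex_series a : tail_small a -> ex_series a.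
Proof.
  intros Ha. apply ex_series_incr_1.
  apply (ex_series_le (K := R_AbsRing) (V := R_CompleteNormedModule) _
           (fun n => 24 * (1/8) ^ n)).
  - exact Ha.
  - eexists. apply is_series_geom_8.
Qed.

Lemma tail_small_Series a : tail_small a -> Rabs (Series a - a 0%nat) <= 28.
Proof.
  intros Ha. rewrite Series_incr_1 by now apply tail_small_ex_series.
  replace (a 0%nat + Series (fun k => a (S k)) - a 0%nat)
    with (Series (fun k => a (S k))) by ring.
  assert (Hex : ex_series (fun n => 24 * (1/8) ^ n)) by (eexists; apply is_series_geom_8).
  eapply Rle_trans; [apply Series_Rabs|].
  - apply (ex_series_le (K := R_AbsRing) (V := R_CompleteNormedModule) _
             (fun n => 24 * (1/8) ^ n)); [|exact Hex].
    intros n. unfold norm; cbn. rewrite Rabs_Rabsolu. apply Ha.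
  - eapply Rle_trans; [apply Series_le; [|exact Hex]|].
    + intros n. split; [apply Rabs_pos | apply Ha].
    + rewrite (is_series_unique _ _ is_series_geom_8). lra.
Qed.

Lemma Series_telescope (a b f : nat -> R) :
  ex_series a -> ex_series b -> ex_series f -> f 0%nat = 0 ->
  (forall n, a n - b n = f (S n) - f n) -> Series a = Series b.
Proof.
  intros Ha Hb Hf H0 E.
  apply Rminus_diag_uniq.
  rewrite <- Series_minus by assumption.
  rewrite (Series_ext _ _ E).
  rewrite Series_minus; [|now apply (ex_series_incr_1 f) | assumption].
  rewrite (Series_incr_1 f) by assumption. rewrite H0. ring.
Qed.

Definition wz_sum (k : R) : R := Series (fun n => summand n k).

(** Taken termwise, so that its recurrence follows from [dwz_identity] with no exchange
    of sum and derivative. *)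
Definition dwz_sum (k : R) : R := Series (fun n => dsummand n k).

Lemma wz_pair_ex_series k : 0 <= k ->
  ex_series (fun n => summand n k) /\ ex_series (fun n => dsummand n k)
  /\ ex_series (fun n => antidiff n k) /\ ex_series (fun n => dantidiff n k).
Proof.
  intros Hk. destruct (wz_pair_tail_small k Hk) as (H1 & H2 & H3 & H4).
  repeat split; now apply tail_small_ex_series.
Qed.

Lemma ex_series_Rmult (c : R) (a : nat -> R) : ex_series a -> ex_series (fun n => c * a n).
Proof. exact (ex_series_scal_l (K := R_AbsRing) (V := R_NormedModule) c a). Qed.

Lemma wz_sum_shift k : 0 <= k ->
  wz_sum k = shift_ratio k * wz_sum (k + 1)
  /\ dwz_sum k
     = shift_ratio k
       * (dwz_sum (k + 1) + (4 / (k + 1/2) - 4 / (k + 1)) * wz_sum (k + 1)).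
Proof.
  intros Hk. unfold wz_sum, dwz_sum.
  destruct (wz_pair_ex_series k Hk) as (H1 & H2 & H3 & H4).
  destruct (wz_pair_ex_series (k + 1) ltac:(lra)) as (H1' & H2' & _ & _).
  rewrite <- !Series_scal_l.
  assert (Hc : ex_series (fun n => (4 / (k + 1/2) - 4 / (k + 1)) * summand n (k + 1)))
    by now apply ex_series_Rmult.
  split; symmetry.
  - apply Series_telescope with (fun n => antidiff n k); try assumption.
    + now apply ex_series_Rmult.
    + unfold antidiff, certificate. cbn. ring.
    + intros n. apply wz_identity. lra.
  - rewrite <- Series_plus, <- Series_scal_l by assumption.
    apply Series_telescope with (fun n => dantidiff n k); try assumption.
    + apply ex_series_Rmult.
      now apply (ex_series_plus (K := R_AbsRing) (V := R_NormedModule)).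
    + unfold dantidiff, certificate. cbn. ring.
    + intros n. apply dwz_identity. lra.
Qed.

(** The logarithmic derivatives [4 / (j+1/2) - 4 / (j+1)] picked up for [j < N] add up
    to [8 (H_(2N) - H_N)]. *)
Lemma wz_sum_iterate N :
  wz_sum 0 = central_ratio N ^ 4 * wz_sum (INR N)
  /\ dwz_sum 0 = central_ratio N ^ 4 * (dwz_sum (INR N) + 8 * harmonic_gap N * wz_sum (INR N)).
Proof.
  induction N as [|N [IH1 IH2]].
  - rewrite central_ratio_0, harmonic_gap_0. cbn [INR]. split; ring.
  - destruct (wz_sum_shift (INR N) (pos_INR N)) as [E1 E2].
    rewrite IH2, IH1, E2, E1, central_ratio_S, harmonic_gap_S, S_INR.
    assert (HN := pos_INR N). unfold shift_ratio. split; field; lra.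
Qed.

(** All terms except the one at [n = 0] contribute a bounded amount, and that term is
    [weight 0 N] or [dweight 0 N]. *)
Lemma wz_sum_growth N :
  Rabs (wz_sum (INR N) - 2 * INR N ^ 2) <= INR N + 30
  /\ Rabs (dwz_sum (INR N)) <= 6 * INR N + 40.
Proof.
  assert (HN := pos_INR N).
  destruct (wz_pair_tail_small (INR N) HN) as (H1 & H2 & _ & _).
  assert (B1 := tail_small_Series _ H1). assert (B2 := tail_small_Series _ H2).
  fold (wz_sum (INR N)) in B1. fold (dwz_sum (INR N)) in B2.
  destruct (weight_bounds 0 (INR N) HN) as [_ Hd].
  unfold summand, dsummand in B1, B2. cbn [term dlog_term] in B1, B2.
  apply Rabs_le_between in B1, B2, Hd. unfold weight in B1. cbn [INR] in B1, Hd.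
  assert (Hq : 0 <= (0 + 1/2) ^ 5 * (2 * INR N + 3 * 0 + 3/2) / (INR N + 2 * 0 + 1) ^ 4 <= 1).
  { split.
    - apply Rdiv_le_0_compat; [|apply pow_lt; lra].
      apply Rmult_le_pos; [apply pow_le; lra | lra].
    - apply Rle_div_l; [apply pow_lt; lra|].
      assert (1 + 4 * INR N <= (INR N + 2 * 0 + 1) ^ 4).
      { assert (0 <= INR N ^ 2 /\ 0 <= INR N ^ 3 /\ 0 <= INR N ^ 4)
          by (repeat split; apply pow_le; lra).
        replace ((INR N + 2 * 0 + 1) ^ 4)
          with (INR N ^ 4 + 4 * INR N ^ 3 + 6 * INR N ^ 2 + 4 * INR N + 1) by ring. lra. }
      lra. }
  split; apply Rabs_le; lra.
Qed.

(** * Evaluation at parameter zero *)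

Lemma wz_sum_0 : wz_sum 0 = 2 / PI ^ 2.
Proof.
  assert (HPI := PI_RGT_0).
  assert (L1 : is_lim_seq
    (fun n => 2 * (INR n * central_ratio n ^ 2) ^ 2
              + central_ratio n ^ 4 * (wz_sum (INR n) - 2 * INR n ^ 2)) (2 / PI ^ 2)).
  { replace (Finite (2 / PI ^ 2)) with (Finite (2 * (/ PI * (/ PI * 1)) + 0)) by (f_equal; field; lra).
    apply is_lim_seq_plus'.
    - apply is_lim_seq_mult'; [apply is_lim_seq_const|].
      cbn [pow]. repeat apply is_lim_seq_mult'; try apply wallis_limit. apply is_lim_seq_const.
    - apply is_lim_seq_abs_0.
      apply is_lim_seq_le_le with (fun _ => 0) (fun n => central_ratio n ^ 4 * (1 * INR n + 30)).
      + intros n. split; [apply Rabs_pos|].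
        assert (Hc : 0 < central_ratio n ^ 4) by (apply pow_lt, central_ratio_pos).
        rewrite Rabs_mult, (Rabs_pos_eq (central_ratio n ^ 4)) by lra.
        apply Rmult_le_compat_l; [lra|]. destruct (wz_sum_growth n). lra.
      + apply is_lim_seq_const.
      + apply central_ratio_pow4_mult_affine. }
  apply is_lim_seq_ext with (v := fun _ => wz_sum 0) in L1.
  - apply is_lim_seq_unique in L1. rewrite Lim_seq_const in L1. now injection L1.
  - intros n. destruct (wz_sum_iterate n) as [E _]. rewrite E. ring.
Qed.

Lemma dwz_sum_0 : dwz_sum 0 = 8 * ln 2 * wz_sum 0.
Proof.
  assert (L1 : is_lim_seq
    (fun n => 8 * harmonic_gap n * wz_sum 0 + central_ratio n ^ 4 * dwz_sum (INR n)) (8 * ln 2 * wz_sum 0)).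
  { replace (Finite (8 * ln 2 * wz_sum 0)) with (Finite (8 * ln 2 * wz_sum 0 + 0)) by (f_equal; ring).
    apply is_lim_seq_plus'.
    - repeat apply is_lim_seq_mult'; try apply is_lim_seq_const. apply harmonic_gap_limit.
    - apply is_lim_seq_abs_0.
      apply is_lim_seq_le_le with (fun _ => 0) (fun n => central_ratio n ^ 4 * (6 * INR n + 40)).
      + intros n. split; [apply Rabs_pos|].
        assert (Hc : 0 < central_ratio n ^ 4) by (apply pow_lt, central_ratio_pos).
        rewrite Rabs_mult, (Rabs_pos_eq (central_ratio n ^ 4)) by lra.
        apply Rmult_le_compat_l; [lra|]. now destruct (wz_sum_growth n).
      + apply is_lim_seq_const.
      + apply central_ratio_pow4_mult_affine. }
  apply is_lim_seq_ext with (v := fun _ => dwz_sum 0) in L1.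
  - apply is_lim_seq_unique in L1. rewrite Lim_seq_const in L1. now injection L1.
  - intros n. destruct (wz_sum_iterate n) as [E1 E2]. rewrite E2, E1. ring.
Qed.

Lemma term_0 n : term n 0 = Binomial.C (2 * n) n ^ 5 / (- 2 ^ 20) ^ n.
Proof.
  transitivity (central_ratio n ^ 5 * (- (1/1024)) ^ n).
  - induction n as [|n IH].
    + rewrite central_ratio_0. cbn. ring.
    + cbn [term]. rewrite IH, central_ratio_S. assert (Hn := pos_INR n).
      cbn [pow]. field. lra.
  (* [- 2^20 = 4^5 * (- 1024)]. *)
  - unfold central_ratio, Rdiv. rewrite Rpow_mult_distr, Rmult_assoc. f_equal.
    rewrite pow_inv, <- pow_mult, Nat.mul_comm, pow_mult, <- !pow_inv, <- Rpow_mult_distr.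
    f_equal. field.
Qed.

Lemma dlog_term_0 n : dlog_term n 0 = 4 * harmonic_gap n.
Proof.
  induction n as [|n IH].
  - rewrite harmonic_gap_0. cbn. ring.
  - cbn [dlog_term]. rewrite IH, harmonic_gap_S. assert (Hn := pos_INR n). field. lra.
Qed.

Theorem theorem1p4 :
  is_series
    (fun k : nat =>
       Binomial.C (2 * k) k ^ 5 / (- 2 ^ 20) ^ k
       * ((820 * INR k ^ 2 + 180 * INR k + 13)
            * (harmonic (2 * k) - harmonic k)
          + 164 * INR k + 18))
    (256 * ln 2 / PI ^ 2).
Proof.
  assert (HPI := PI_RGT_0).
  destruct (wz_pair_ex_series 0 ltac:(lra)) as (_ & H & _ & _).
  apply Series_correct in H. fold (dwz_sum 0) in H. rewrite dwz_sum_0, wz_sum_0 in H.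
  (* [weight n 0] carries a factor 1/64 and [dlog_term n 0] a factor 4. *)
  apply (is_series_scal_l (K := R_AbsRing) (V := R_NormedModule) 16) in H.
  replace (256 * ln 2 / PI ^ 2) with (16 * (8 * ln 2 * (2 / PI ^ 2))) by (field; lra).
  revert H. apply is_series_ext. intros n. cbn beta.
  unfold dsummand, weight, dweight.
  rewrite term_0, dlog_term_0. fold (harmonic_gap n). assert (Hn := pos_INR n).
  set (c := Binomial.C (2 * n) n ^ 5 / (- 2 ^ 20) ^ n).
  unfold scal; cbn -[INR]; unfold mult; cbn -[INR].
  field. lra.
Qed.
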